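(* Every randomized online algorithm for node-weighted Steiner tree with deadlines (or with delay), and every randomized online algorithm for directed Steiner tree with deadlines (or with delay), has competitive ratio $\Omega(\sqrt{\log n})$, where $n$ is the number of vertices of the input graph (this holds regardless of the algorithm's computational power).
   Context: Node-weighted Steiner tree with deadlines: given in advance a graph $G=(V,E)$, $|V|=n$, vertex costs $c:V\to\mathbb{R}^+$ and a root $\rho\in V$; requests arrive over time, each request $q$ a vertex $v$ released at time $r_q$ with deadline $d_q$ revealed at release; at any time the algorithm may transmit $V'\subseteq V$ at cost $\sum_{u\in V'}c(u)$, serving every pending request $v$ such that $v$ and $\rho$ are in the same connected component of the subgraph induced by $V'$; each request must be served within $[r_q,d_q]$; cost is total transmission cost. Directed Steiner tree with deadlines: same, but $G$ is directed with edge costs $c:E\to\mathbb{R}^+$, the algorithm transmits edge sets $E'\subseteq E$ at cost $\sum_{e\in E'}c(e)$, and request $v$ is served if $(V,E')$ contains a directed path from $\rho$ to $v$. The delay versions replace deadlines by continuous, monotone non-decreasing delay functions $d_q(t)$ tending to infinity, revealed at release, and add to the cost the delay $d_q(t_q)$ accumulated by each request until its service time $t_q$. A randomized online algorithm is $\alpha$-competitive if on every input its expected cost is at most $\alpha$ times the optimal offline cost. *)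

(* Defs.v *)
From HB Require Import structures.
From mathcomp Require Import all_boot all_order all_algebra.
From mathcomp Require Import all_classical all_reals all_analysis measurable_realfun.
Set Implicit Arguments.
Unset Strict Implicit.
Unset Printing Implicit Defensive.
Import Order.TTheory GRing.Theory Num.Theory.
Import numFieldNormedType.Exports.
Local Open Scope classical_set_scope.
Local Open Scope ring_scope.

(* What an online algorithm knows in advance. A transmission is a finite set
   of items (vertices or edges), paid item by item; [connects T v] says that
   transmitting [T] connects [v] to the root. *)
Record network (R : realType) (n : nat) := Network {
  item : finType;
  price : item -> R;
  connects : {set item} -> 'I_n -> bool }.

Record node_weighted_graph (R : realType) (n : nat) := NodeWeightedGraph {
  adj : rel 'I_n;
  adj_sym : symmetric adj;
  adj_irr : irreflexive adj;
  vertex_cost : 'I_n -> R;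
  vertex_cost_gt0 : forall v, 0 < vertex_cost v;
  nw_root : 'I_n }.

(* [connect] is reflexive, so membership of both endpoints is required
   separately. *)
Definition induced_connects (R : realType) (n : nat)
    (G : node_weighted_graph R n) (V' : {set 'I_n}) (v : 'I_n) : bool :=
  [&& v \in V', nw_root G \in V' &
      connect [rel x y | [&& x \in V', y \in V' & adj G x y]] (nw_root G) v].

Definition node_weighted_network (R : realType) (n : nat)
    (G : node_weighted_graph R n) : network R n :=
  Network (@vertex_cost R n G) (induced_connects G).

Record edge_weighted_digraph (R : realType) (n : nat) := EdgeWeightedDigraph {
  arcs : {set 'I_n * 'I_n};
  arc_cost : {e : 'I_n * 'I_n | e \in arcs} -> R;
  arc_cost_gt0 : forall e, 0 < arc_cost e;
  dir_root : 'I_n }.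

Definition directed_connects (R : realType) (n : nat)
    (G : edge_weighted_digraph R n)
    (E' : {set {e : 'I_n * 'I_n | e \in arcs G}}) (v : 'I_n) : bool :=
  connect [rel x y | [exists e in E', val e == (x, y)]] (dir_root G) v.

Definition directed_network (R : realType) (n : nat)
    (G : edge_weighted_digraph R n) : network R n :=
  Network (@arc_cost R n G) (@directed_connects R n G).

(* [penalty q t] is the cost incurred by request [q] when it is served at time
   [t], where [t = +oo] means that [q] is never served. *)
Record request_model (R : realType) (n : nat) := RequestModel {
  request : Type;
  vertex : request -> 'I_n;
  release : request -> R;
  penalty : request -> \bar R -> \bar R }.

Record deadline_request (R : realType) (n : nat) := DeadlineRequest {
  dl_vertex : 'I_n;
  dl_release : R;
  deadline : R;
  dl_release_le : dl_release <= deadline }.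

(* The requirement that every request be served by its deadline is encoded by
   an infinite cost. *)
Definition deadlines (R : realType) (n : nat) : request_model R n :=
  RequestModel (@dl_vertex R n) (@dl_release R n)
    (fun q t => if (t <= (deadline q)%:E)%E then 0%E else +oo%E).

Record delay_request (R : realType) (n : nat) := DelayRequest {
  dy_vertex : 'I_n;
  dy_release : R;
  delay : R -> R;
  delay_ge0 : forall t, dy_release <= t -> 0 <= delay t;
  delay_continuous : {within `[dy_release, +oo[, continuous delay};
  delay_nondecreasing :
    forall s t, dy_release <= s -> s <= t -> delay s <= delay t;
  delay_infty : delay t @[t --> +oo] --> +oo }.

Definition delays (R : realType) (n : nat) : request_model R n :=
  RequestModel (@dy_vertex R n) (@dy_release R n)
    (fun q t => if t is EFin u then (delay q u)%:E else +oo%E).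

Section Problem.
Context (R : realType) (n : nat) (N : network R n) (M : request_model R n).

Definition input := seq (request M).

(* The finite multiset of (time, transmitted set) pairs; the order of the list
   is irrelevant. *)
Definition schedule := seq (R * {set item N}).

Definition service_time (s : schedule) (q : request M) : \bar R :=
  \big[Order.min/+oo%E]_(x <- s | (release q <= x.1) && connects x.2 (vertex q))
    x.1%:E.

Definition cost (I : input) (s : schedule) : \bar R :=
  ((\sum_(x <- s) \sum_(i in x.2) price i)%:E
   + \sum_(q <- I) penalty q (service_time s q))%E.

Definition opt (I : input) : \bar R := ereal_inf (range (cost I)).

(* Transmissions made up to time [t] depend only on the requests released up to
   time [t]; a request, with its deadline or its whole delay function, is
   revealed at its release. *)
Definition online (A : input -> schedule) : Prop :=
  forall (t : R) (I J : input),
    [seq q <- I | release q <= t] = [seq q <- J | release q <= t] ->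
    perm_eq [seq x <- A I | x.1 <= t] [seq x <- A J | x.1 <= t].

(* A randomized algorithm draws its random seed, then runs a deterministic
   online algorithm. *)
Record randomized_algorithm := RandomizedAlgorithm {
  seed_display : measure_display;
  seed : measurableType seed_display;
  seed_law : probability seed R;
  run : seed -> input -> schedule;
  run_online : forall w, online (run w);
  run_measurable : forall I, measurable_fun setT (fun w => cost I (run w I)) }.

Definition expected_cost (A : randomized_algorithm) (I : input) : \bar R :=
  (\int[seed_law A]_w cost I (run (w : seed A) I))%E.

End Problem.

(* [A] gives, for every graph in the class [G], the behaviour of the algorithm
   on that graph, which is known in advance. *)
Definition competitive (R : realType) (n : nat) (G : Type)
    (net : G -> network R n) (M : request_model R n)
    (A : forall g, randomized_algorithm (net g) M) (alpha : R) : Prop :=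
  forall (g : G) (I : input M),
    (expected_cost (A g) I <= alpha%:E * opt (net g) I)%E.

(* Main.v *)
Require Import Defs.
From HB Require Import structures.
From mathcomp Require Import all_boot all_order all_algebra.
From mathcomp Require Import all_classical all_reals all_analysis.
From mathcomp Require Import fintype finset.
From mathcomp Require Import zify ring lra.
Set Implicit Arguments.
Unset Strict Implicit.
Unset Printing Implicit Defensive.
Import Order.TTheory GRing.Theory Num.Theory.
Import numFieldNormedType.Exports.
Local Open Scope ring_scope.

(** A point is a set of bits (the [2 ^ b] relevant points are the expensive
    sets of a set cover instance), and an element is a subcube: it is served by
    buying any of its points.  The hard random instance of level [i] on a
    subcube [e] first requests all [2 ^ i] subcubes obtained from [e] by fixing
    the bits below [i], to be served by the very end.  It then runs an instance
    of level [i - l] on [e], draws the bits [i - 1], ..., [i - l] at random, and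
    after each draw runs an instance of level [i - 1], ..., [i - l] on the half
    of the current subcube that was not drawn.  Offline, every point is bought
    exactly once: the points of the final subcube during the instance of level
    [i - l], the others in their own half.  Online, whatever is bought during
    that first instance spreads over [2 ^ l] candidate subcubes, and the still
    unserved initial requests in the one finally drawn are paid for on top of
    all the subinstances.  As long as the ratio at level [i - l] is at most
    [2 ^ l / 2], this raises the ratio by about [1 / 2 ^ l] in exchange for
    about two levels.  With [b = 4 ^ l] levels and about [4 ^ b] vertices, the
    ratio reaches the order of [2 ^ l], i.e. of [sqrt b]. *)

(** * Averages over finite lists *)

Section Average.
Context (R : realFieldType) (T : eqType).

Definition avg (L : seq T) (F : T -> R) : R := (\sum_(x <- L) F x) / (size L)%:R.

Lemma ler_avg (L : seq T) (F G : T -> R) :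
  {in L, forall x, F x <= G x} -> avg L F <= avg L G.
Proof.
move=> FG; rewrite /avg ler_wpM2r ?invr_ge0 ?ler0n// big_seq [leRHS]big_seq.
exact: ler_sum.
Qed.

Lemma avgD (L : seq T) (F G : T -> R) :
  avg L (fun x => F x + G x) = avg L F + avg L G.
Proof. by rewrite /avg big_split mulrDl. Qed.

Lemma avgZ (L : seq T) (a : R) (F : T -> R) :
  avg L (fun x => a * F x) = a * avg L F.
Proof. by rewrite /avg -mulr_sumr mulrA. Qed.

Lemma avg_cst (L : seq T) (a : R) : (0 < size L)%N -> avg L (fun=> a) = a.
Proof.
move=> L0; rewrite /avg big_const_seq count_predT iter_addr addr0 -[_ *+ _]mulr_natr mulfK//.
by rewrite pnatr_eq0 -lt0n.
Qed.

Lemma avg1 (x : T) (F : T -> R) : avg [:: x] F = F x.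
Proof. by rewrite /avg big_seq1 divr1. Qed.

Lemma avg_cat (L L' : seq T) (F : T -> R) : size L = size L' ->
  avg (L ++ L') F = (avg L F + avg L' F) / 2.
Proof.
move=> s; rewrite /avg big_cat size_cat -s addnn -muln2 natrM invfM.
by rewrite -mulrDl mulrA.
Qed.

Lemma avg_allpairs (h : T -> T -> T) (L L' : seq T) (F : T -> R) :
  avg [seq h x y | x <- L, y <- L'] F =
  avg L (fun x => avg L' (fun y => F (h x y))).
Proof.
by rewrite /avg big_allpairs_dep size_allpairs natrM invfM -mulr_suml -mulrA [X in _ * X]mulrC.
Qed.

End Average.

(** * Subcubes and the random instances *)

Section Game.
Context (b : nat).

(* Only the bits below [b] are ever fixed; there are [b.+1] of them to make [inord] available. *)
Definition pt := {set 'I_b.+1}.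

Definition bit (p : pt) (k : nat) : bool := inord k \in p.

(* A subcube: the bits fixed to 1 and the bits fixed to 0. *)
Definition elt := (pt * pt)%type.

Definition cov (e : elt) (p : pt) : bool := (e.1 \subset p) && [disjoint e.2 & p].

Definition fixbit (e : elt) (k : nat) (c : bool) : elt :=
  if c then (inord k |: e.1, e.2) else (e.1, inord k |: e.2).

Arguments fixbit : simpl never.
Arguments cov : simpl never.

Lemma cov_fixbit e k c p : cov (fixbit e k c) p = cov e p && (bit p k == c).
Proof.
rewrite /cov /bit /fixbit; case: c => /=.
  by rewrite subUset sub1set eqb_id -andbA andbC -!andbA.
by rewrite !disjoints_subset subUset sub1set in_setC eqbF_neg andbA andbAC.
Qed.

(* Time is cut into unit slots; a request may be served in the slots from its
   arrival to its due slot, both included. *)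
Definition req := (elt * nat * nat)%type.
Definition target (q : req) : elt := q.1.1.
Definition arrival (q : req) : nat := q.1.2.
Definition due (q : req) : nat := q.2.

(** The top bit is split first, as in [tail], so each draw keeps exactly one of the two sublists. *)
Fixpoint pend (i : nat) (e : elt) (t d : nat) : seq req :=
  if i is i'.+1 then pend i' (fixbit e i' false) t d ++ pend i' (fixbit e i' true) t d
  else [:: (e, t, d)].

Lemma pendP i e t d q : q \in pend i e t d -> arrival q = t /\ due q = d.
Proof.
elim: i e => [|i IH] e /=; first by rewrite inE => /eqP ->.
by rewrite mem_cat => /orP[] /IH.
Qed.

Section Instances.
Context (l : nat).

(* [branch c] is the case where the drawn value of bit [i.-1] is [c]. *)
Fixpoint tail (g : nat -> elt -> nat -> seq (seq req)) (j i : nat) (e : elt) (s : nat) :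
    seq (seq req) :=
  if j is j'.+1 then
    let branch c := [seq x ++ y | x <- g i.-1 (fixbit e i.-1 (~~ c)) s,
      y <- tail g j' i.-1 (fixbit e i.-1 c) (s + 2 ^ i.-1)] in
    branch false ++ branch true
  else [:: [::]].

(* A uniformly random member of [inst f i e t], whose requests live in the
   slots [t, t + 2 ^ i), is the hard input; [f] is fuel. *)
Fixpoint inst (f i : nat) (e : elt) (t : nat) : seq (seq req) :=
  if f is f'.+1 then
    if (i < l)%N then [:: [::]] else
    [seq pend i e t (t + 2 ^ i).-1 ++ (x ++ y) | x <- inst f' (i - l) e t,
      y <- tail (inst f') l i e (t + 2 ^ (i - l))]
  else [:: [::]].

Definition in_slots (s t : nat) (q : req) : bool := (s <= arrival q <= due q)%N && (due q < t)%N.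

(** Equal sizes give the two branches of [tail] the same weight in the average over their
    concatenation. *)
Definition size_uniform (g : nat -> elt -> nat -> seq (seq req)) :=
  forall i e t e' t', size (g i e t) = size (g i e' t').

Lemma size_tail g j i e s e' s' : size_uniform g ->
  size (tail g j i e s) = size (tail g j i e' s').
Proof.
move=> gU; elim: j i e s e' s' => //= j IH i e s e' s'.
rewrite !size_cat !size_allpairs.
by congr (_ * _ + _ * _)%N; (apply: gU || apply: IH).
Qed.

Lemma size_inst f : size_uniform (inst f).
Proof.
elim: f => // f IH i e t e' t' /=; case: ifP => // _.
by rewrite !size_allpairs; congr (_ * _)%N; [apply: IH | apply: size_tail].
Qed.

Lemma size_tail_gt0 g j i e s : (forall i e t, 0 < size (g i e t))%N ->
  (0 < size (tail g j i e s))%N.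
Proof.
move=> g0; elim: j i e s => //= j IH i e s.
by rewrite size_cat !size_allpairs addn_gt0 !muln_gt0 !IH !g0.
Qed.

Lemma size_inst_gt0 f i e t : (0 < size (inst f i e t))%N.
Proof.
elim: f i e t => //= f IH i e t; case: ifP => // _.
by rewrite size_allpairs muln_gt0 IH size_tail_gt0.
Qed.

Lemma sub_within s t s' t' x : (s' <= s)%N -> (t <= t')%N ->
  all (in_slots s t) x -> all (in_slots s' t') x.
Proof.
move=> ss tt; apply: sub_all => q /andP[/andP[a w] d].
by rewrite /in_slots (leq_trans ss a) w (leq_trans d tt).
Qed.

(** The subinstances occupy [2 ^ (i - 1) + ... + 2 ^ (i - j) = 2 ^ i - 2 ^ (i - j)] slots. *)
Lemma tail_within g j i e s x :
  (forall i e t x, x \in g i e t -> all (in_slots t (t + 2 ^ i)) x) ->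
  (j <= i)%N -> x \in tail g j i e s -> all (in_slots s (s + 2 ^ i - 2 ^ (i - j))) x.
Proof.
move=> gW; elim: j i e s x => [|j IH] [|i] e s x //=; do ?by rewrite inE => _ /eqP ->.
rewrite ltnS subSS => ji.
have E : (2 ^ (i - j) <= 2 ^ i)%N by rewrite leq_exp2l ?leq_subr.
rewrite mem_cat => /orP[] /allpairsP[[y z] /= [yg zt ->]]; rewrite all_cat;
 (apply/andP; split; [apply: sub_within (gW _ _ _ _ yg); rewrite ?expnS; lia|
   apply: sub_within (IH _ _ _ _ ji zt); rewrite ?expnS; lia]).
Qed.

Lemma inst_within f i e t x : x \in inst f i e t -> all (in_slots t (t + 2 ^ i)) x.
Proof.
elim: f i e t x => [|f IH] i e t x /=; first by rewrite inE => /eqP ->.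
case: ltnP => [_|li]; first by rewrite inE => /eqP ->.
case/allpairsP => -[y z] /= [yg zt ->].
have E : (2 ^ (i - l) <= 2 ^ i)%N by rewrite leq_exp2l ?leq_subr.
have E' : (0 < 2 ^ i)%N by rewrite expn_gt0.
rewrite !all_cat; apply/and3P; split.
- by apply/allP => q /pendP[a d]; rewrite /in_slots a d; lia.
- by apply: sub_within (IH _ _ _ _ yg); lia.
- by apply: sub_within (tail_within IH li zt); lia.
Qed.

(** * Lower bound on the online cost *)

Section LowerBound.
(* [a I u p] is the number of times the algorithm buys [p] in slot [u]. *)
Context (a : seq req -> nat -> pt -> nat)
  (a_online : forall u I J,
    [seq q <- I | (arrival q <= u)%N] = [seq q <- J | (arrival q <= u)%N] ->
    a I u =1 a J u).

Definition cnt (I : seq req) (s t : nat) (B : pred pt) : nat :=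
  \sum_(s <= u < t) \sum_(p | B p) a I u p.

Definition unserved (I : seq req) (q : req) : bool :=
  cnt I (arrival q) (due q).+1 (cov (target q)) == 0%N.

Definition nuns (I x : seq req) : nat := count (unserved I) x.

Lemma cnt_split I s t e k : cnt I s t (cov e) =
  (cnt I s t (cov (fixbit e k false)) + cnt I s t (cov (fixbit e k true)))%N.
Proof.
rewrite /cnt -big_split; apply: eq_bigr => u _ /=.
rewrite (bigID (fun p => bit p k)) /= addnC.
by congr (_ + _)%N; apply: eq_bigl => p; rewrite cov_fixbit ?eqbF_neg ?eqb_id.
Qed.

Lemma cnt_cat I s t u B : (s <= t)%N -> (t <= u)%N ->
  cnt I s u B = (cnt I s t B + cnt I t u B)%N.
Proof. by move=> st tu; rewrite /cnt (big_cat_nat st tu). Qed.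

Lemma cnt_sub I s t s' t' B : (s' <= s)%N -> (s <= t)%N -> (t <= t')%N ->
  (cnt I s t B <= cnt I s' t' B)%N.
Proof.
move=> ss st tt; rewrite (@cnt_cat _ s' s)//; last exact: leq_trans st tt.
by rewrite (@cnt_cat _ s t t')// addnCA leq_addr.
Qed.

Lemma cnt_online I z s t B : all (fun q => t <= arrival q)%N z ->
  cnt (I ++ z) s t B = cnt I s t B.
Proof.
move=> /allP z_late; rewrite /cnt; apply: eq_big_nat => u /andP[_ ut].
apply: eq_bigr => p _; apply: a_online; rewrite filter_cat.
rewrite (_ : [seq q <- z | _] = [::]) ?cats0//.
rewrite -(filter_pred0 z); apply: eq_in_filter => q /z_late tq /=.
by apply/negbTE; rewrite -ltnNge; exact: leq_trans ut tq.
Qed.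

Lemma nuns_cat I x y : nuns I (x ++ y) = (nuns I x + nuns I y)%N.
Proof. exact: count_cat. Qed.

Lemma nuns_online I z s t x : all (in_slots s t) x ->
  all (fun q => t <= arrival q)%N z -> nuns (I ++ z) x = nuns I x.
Proof.
move=> /allP xW /allP z_late; apply: eq_in_count => q /xW /andP[_ dt].
rewrite /unserved cnt_online//; apply/allP => r /z_late; exact: leq_trans.
Qed.

(** The [2 ^ i] requested subcubes are pairwise disjoint, so no purchase serves two of them. *)
Lemma pend_paid I i e t d :
  (2 ^ i <= cnt I t d.+1 (cov e) + nuns I (pend i e t d))%N.
Proof.
elim: i e => [|i IH] e /=.
  by rewrite /nuns /= /unserved /arrival /due /target /=; case: cnt.
rewrite nuns_cat (cnt_split _ _ _ _ i) expnS.
have := IH (fixbit e i false); have := IH (fixbit e i true); lia.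
Qed.

Context (R : realFieldType).

(** Against the offline bound [2 ^ i.+1] this is the ratio [(i - l) / (8 * 2 ^ l)]. Truncated
    subtraction gives 0 below level [l], where the instances are empty. *)
Definition alg_lb (i : nat) : R := 2 ^+ i * (i - l)%:R / (4 * 2 ^+ l).
(* A discrete primitive of the lower bound [alg_lb]. *)
Definition prim (i : nat) : R := 2 ^+ i * (i%:R - l%:R - 2) / (4 * 2 ^+ l).

(** The [- 2] in [prim] makes both sides equal for [l <= i]; below, [alg_lb i] is 0 and the
    difference is negative. *)
Lemma prim_step i : prim i.+1 - prim i <= alg_lb i.
Proof.
rewrite /prim /alg_lb exprS -(natr1 i) -mulrBl ler_wpM2r ?invr_ge0 ?mulr_ge0 ?exprn_ge0//.
rewrite [leLHS](_ : _ = 2 ^+ i * (i%:R - l%:R)); last by ring.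
rewrite ler_wpM2l ?exprn_ge0//.
case: (leqP l i) => h; first by rewrite natrB.
by rewrite (eqP (ltnW h)) subr_le0 ler_nat ltnW.
Qed.

(* Every unserved request is charged one unit, the price of a point. *)
Definition toll (I : seq req) (s t : nat) (e : elt) (x : seq req) : R :=
  (cnt I s t (cov e) + nuns I x)%:R.

Lemma late_of_within s t x u : (u <= s)%N -> all (in_slots s t) x ->
  all (fun q => u <= arrival q)%N x.
Proof. by move=> us; apply: sub_all => q /andP[/andP[h _] _]; exact: leq_trans us h. Qed.

(* [cnt pre t t1 (cov e)] counts the points bought before the tail starts; each
   drawn bit halves it on average, because the algorithm cannot predict the draw. *)
Lemma tail_bound g j i e s pre t t1 d :
  (forall i e t x, x \in g i e t -> all (in_slots t (t + 2 ^ i)) x) ->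
  size_uniform g -> (forall i e t, 0 < size (g i e t))%N ->
  (forall i', (i' < i)%N -> forall pre e t,
     alg_lb i' <= avg (g i' e t) (fun x => toll (pre ++ x) t (t + 2 ^ i') e x)) ->
  (j <= i)%N -> (t <= t1)%N -> (t1 <= s)%N -> (s + 2 ^ i <= d.+1 + 2 ^ (i - j))%N ->
  prim i - prim (i - j) + (2 ^+ i - (cnt pre t t1 (cov e))%:R) / 2 ^+ j <=
  avg (tail g j i e s)
    (fun y => toll (pre ++ y) t1 d.+1 e y + (nuns (pre ++ y) (pend i e t d))%:R).
Proof.
move=> gW gU g0; elim: j i e s pre => [|j IH] [|i] e s pre // gB ji tt1 t1s sd.
(* No bit is left to draw: by [pend_paid], what was not bought before [t1] is bought later or left
   unserved. *)
- rewrite avg1 /toll cats0 /= subrr add0r !divr1 -natrD.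
  have := @pend_paid pre 0 e t d; rewrite (@cnt_cat _ t t1)//; last by move: sd; rewrite subn0; lia.
  by rewrite -(ler_nat R) !natrD /=; lra.
- rewrite avg1 /toll cats0 subn0 subrr add0r divr1 -natrD.
  have := @pend_paid pre i.+1 e t d; rewrite (@cnt_cat _ t t1)//; last by move: sd; rewrite subn0; lia.
  by rewrite -(ler_nat R) !natrD natrX /=; lra.
rewrite ltnS in ji; rewrite subSS in sd *.
have E : (2 ^ (i - j) <= 2 ^ i)%N by rewrite leq_exp2l ?leq_subr.
set F := (F in avg _ F).
pose branch c := [seq x ++ y | x <- g i (fixbit e i (~~ c)) s,
      y <- tail g j i (fixbit e i c) (s + 2 ^ i)].
have sz : size (branch false) = size (branch true).
  rewrite !size_allpairs; congr (_ * _)%N; [exact: gU | exact: size_tail].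
(* If [u] and [v] points were bought early in the two halves, the mean of [(2 ^ i - u) / 2 ^ j] and
   [(2 ^ i - v) / 2 ^ j] is [(2 ^ i.+1 - (u + v)) / 2 ^ j.+1]. *)
suff step c : prim i.+1 - prim (i - j) +
    (2 ^+ i - (cnt pre t t1 (cov (fixbit e i c)))%:R) / 2 ^+ j <= avg (branch c) F.
  rewrite -[tail _ _ _ _ _]/(branch false ++ branch true) avg_cat//.
  rewrite (cnt_split _ _ _ _ i) natrD; move: (step false) (step true).
  set A := avg _ _; set B := avg _ _; set u := (cnt _ _ _ _)%:R; set v := (cnt _ _ _ _)%:R.
  rewrite !exprS invfM; set k := (2 ^+ j)^-1. lra.
(* The term [alg_lb i] comes from the subinstance on the half not drawn and dominates
   [prim i.+1 - prim i]. *)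
apply: le_trans (_ : alg_lb i + (prim i - prim (i - j) +
    (2 ^+ i - (cnt pre t t1 (cov (fixbit e i c)))%:R) / 2 ^+ j) <= _).
  have := prim_step i; lra.
rewrite avg_allpairs.
set X := (X in _ + X).
apply: le_trans (_ : avg (g i (fixbit e i (~~ c)) s) (fun x =>
   toll (pre ++ x) s (s + 2 ^ i) (fixbit e i (~~ c)) x + X) <= _).
  by rewrite avgD avg_cst// lerD2r; apply: gB.
apply: ler_avg => x xg.
have xW := gW _ _ _ _ xg.
have sd' : (s + 2 ^ i + 2 ^ i <= d.+1 + 2 ^ (i - j))%N by move: sd; rewrite expnS; lia.
have := IH i (fixbit e i c) (s + 2 ^ i)%N (pre ++ x) _ ji tt1 _ sd'.
have XE : X = prim i - prim (i - j) +
    (2 ^+ i - (cnt (pre ++ x) t t1 (cov (fixbit e i c)))%:R) / 2 ^+ j.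
  by rewrite cnt_online// (late_of_within t1s xW).
rewrite -XE => {}IH.
have {IH}/(lerD (lexx (toll (pre ++ x) s (s + 2 ^ i) (fixbit e i (~~ c)) x))) := 
   IH (fun i' h => gB _ (ltnW h)) (leq_trans t1s (leq_addr _ _)).
move/le_trans; apply.
rewrite -[X in X + _](@avg_cst _ _ (tail g j i (fixbit e i c) (s + 2 ^ i))) ?size_tail_gt0//.
rewrite -avgD; apply: ler_avg => y yt.
have yW := tail_within gW ji yt.
have yL : all (fun q => s + 2 ^ i <= arrival q)%N y by apply: late_of_within yW.
(* The tolls of [x] and [y] add up because they concern opposite halves of [e]; the initial requests
   in the half not drawn are dropped. *)
rewrite /F /toll -!natrD ler_nat /= -catA.
rewrite -(@cnt_online (pre ++ x) y)// -(@nuns_online (pre ++ x) y _ _ _ xW)// -catA.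
rewrite !nuns_cat (cnt_split _ t1 _ e i).
have := @cnt_sub (pre ++ x ++ y) s (s + 2 ^ i) t1 d.+1 (cov (fixbit e i (~~ c))) t1s (leq_addr _ _) ltac:(lia).
move: (cnt _ s _ _) (nuns _ x) (nuns _ y) => n1 n2 n3.
by case: c @branch sz X XE xg yt yW => /= _ X _ _ _ _;
  move: (cnt _ t1 _ (cov (fixbit e i false))) (cnt _ t1 _ (cov (fixbit e i true)));
  move: (nuns _ (pend i (fixbit e i false) t d)) (nuns _ (pend i (fixbit e i true) t d));
  clear; lia.
Qed.

(** Half of the gain [2 ^ i / 2 ^ l] pays for [alg_lb i - prim i]. The other half covers the loss
    [alg_lb (i - l) / 2 ^ l], thanks to [i - l <= 2 * 4 ^ l]. *)
Lemma ratio_step i : (l <= i)%N -> (i <= 2 * 4 ^ l + l)%N ->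
  alg_lb i <= (1 - (2 ^+ l)^-1) * alg_lb (i - l) + (prim i - prim (i - l)) + 2 ^+ i / 2 ^+ l.
Proof.
move=> li iB; rewrite /alg_lb /prim.
have [y iE] : exists y, i = (y + l)%N by exists (i - l)%N; rewrite subnK.
have yB : y%:R <= 2 * (2 ^+ l * 2 ^+ l) :> R.
  by rewrite -exprMn -!natrM -natrX -natrM ler_nat; move: iB; rewrite iE leq_add2r.
rewrite iE addnK natrD exprD; set P := 2 ^+ y; set K := 2 ^+ l.
have P0 : 0 < P by rewrite exprn_gt0.
have K0 : 0 < K by rewrite exprn_gt0.
have w1 : (y%:R - l%:R : R) <= (y - l)%:R.
  case: (leqP l y) => h; first by rewrite natrB.
  by rewrite (eqP (ltnW h)) subr_le0 ler_nat ltnW.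
have w2 : (y - l)%:R <= y%:R :> R by rewrite ler_nat leq_subr.
move: w1 w2; set w : R := (y - l)%:R; set z : R := y%:R in yB *; set l' : R := l%:R.
move=> w1 w2.
have wK : w / K <= 2 * K by rewrite ler_pdivrMr// (le_trans w2)// (le_trans yB)// mulrA.
rewrite -subr_ge0.
have -> : (1 - K^-1) * (P * w / (4 * K)) + (P * K * (z + l' - l' - 2) / (4 * K) -
  P * (z - l' - 2) / (4 * K)) + P * K / K - P * K * z / (4 * K) =
  (w - (z - l') + 2 + (2 * K - w / K)) * (P / (4 * K)) by field; rewrite gt_eqF.
rewrite mulr_ge0//; last by rewrite divr_ge0 ?mulr_ge0 // ltW.
by lra.
Qed.

(** The arbitrary prefix [pre] lets the bound apply inside enclosing instances, whose earlier
    requests the algorithm has seen. *)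
Lemma inst_bound f i e t pre : (0 < l)%N -> (i < f)%N -> (i <= 2 * 4 ^ l + l)%N ->
  alg_lb i <= avg (inst f i e t) (fun x => toll (pre ++ x) t (t + 2 ^ i) e x).
Proof.
move=> l0; elim: f i e t pre => // f IH i e t pre; rewrite ltnS => fi iB /=.
case: ltnP => li.
  by rewrite avg1 /alg_lb (eqP (ltnW li)) mulr0 mul0r ler0n.
have E : (2 ^ (i - l) <= 2 ^ i)%N by rewrite leq_exp2l ?leq_subr.
have E' : (0 < 2 ^ i)%N by rewrite expn_gt0.
set t1 := (t + 2 ^ (i - l))%N; set d := (t + 2 ^ i).-1; set p := pend i e t d.
have dE : d.+1 = (t + 2 ^ i)%N by rewrite /d prednK// addn_gt0 E' orbT.
rewrite avg_allpairs.
pose D x := toll ((pre ++ p) ++ x) t t1 e x.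
(* A point bought during the first subinstance costs 1 but lowers the bound on the tail by
   [1 / 2 ^ l], hence the factor. *)
apply: (@le_trans _ _ (avg (inst f (i - l) e t) (fun x => (1 - (2 ^+ l)^-1) * D x +
  (prim i - prim (i - l) + 2 ^+ i / 2 ^+ l)))).
  rewrite avgD avg_cst ?size_inst_gt0// avgZ addrA.
  apply: le_trans (ratio_step li iB) _; rewrite !lerD2r ler_wpM2l//.
    by rewrite subr_ge0 invf_le1 ?exprn_gt0// exprn_ege1// ler1n.
  by apply: IH; lia.
apply: ler_avg => x xi.
have xW := inst_within xi.
have tb := @tail_bound (inst f) l i e t1 ((pre ++ p) ++ x) t t1 d
  (@inst_within f) (size_inst f) (size_inst_gt0 f) _ li (leq_addr _ _) (leqnn _) _.
apply: le_trans (_ : D x + (prim i - prim (i - l) +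
    (2 ^+ i - (cnt ((pre ++ p) ++ x) t t1 (cov e))%:R) / 2 ^+ l) <= _).
  (* Unserved requests of [x] are discounted as well, so that the induction hypothesis applies to
     the whole toll. *)
  have : 0 <= (nuns ((pre ++ p) ++ x) x)%:R / 2 ^+ l :> R by rewrite divr_ge0 ?exprn_ge0.
  by rewrite /D /toll natrD; lra.
apply: le_trans (lerD (lexx (D x)) (tb _ _)) _.
- by move=> i' i'i pre' e' t'; apply: IH; lia.
- by rewrite /t1 dE; lia.
rewrite -[X in X + _](@avg_cst _ _ (tail (inst f) l i e t1)) ?size_tail_gt0//; last first.
  exact: size_inst_gt0.
rewrite -avgD; apply: ler_avg => y yt.
have yW := tail_within (@inst_within f) li yt.
have yL : all (fun q => t1 <= arrival q)%N y by apply: late_of_within yW.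
rewrite /D /toll -!natrD ler_nat.
rewrite -(@cnt_online _ y t t1)// -(@nuns_online _ y _ _ _ xW)// -!catA !nuns_cat -dE.
rewrite (@cnt_cat _ t t1 d.+1) ?leq_addr// /p; last by rewrite dE /t1; lia.
move: (cnt _ t t1 _) (cnt _ t1 _ _) (nuns _ (pend i e t d)) (nuns _ x) (nuns _ y).
by clear; lia.
Qed.
End LowerBound.

(** * Cheap offline plans *)

Section Offline.

Definition agree (i : nat) (p u : pt) : bool :=
  [forall k : 'I_b.+1, (i <= k)%N ==> ((k \in p) == (k \in u))].

Lemma agreeP i p u : reflect (forall k, (i <= k <= b)%N -> bit p k = bit u k) (agree i p u).
Proof.
apply: (iffP forallP) => h.
  move=> k /andP[ik kb]; have := h (inord k).
  by rewrite inordK ?ltnS// ik => /eqP.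
move=> k; apply/implyP => ik; have := h k; rewrite /bit inord_val => -> //.
by rewrite ik -ltnS ltn_ord.
Qed.

Lemma agree_refl i u : agree i u u.
Proof. exact/agreeP. Qed.

Lemma agree_trans i p u v : agree i p u -> agree i u v -> agree i p v.
Proof. by move=> /agreeP pu /agreeP uv; apply/agreeP => k h; rewrite pu// uv. Qed.

Lemma agree_leq i j p u : (i <= j)%N -> agree i p u -> agree j p u.
Proof.
by move=> ij /agreeP h; apply/agreeP => k /andP[jk kb]; rewrite h// (leq_trans ij jk).
Qed.

Definition setbit (u : pt) (k : nat) (c : bool) : pt :=
  if c then inord k |: u else u :\ inord k.

Lemma bit_setbit u k c k' : (k <= b)%N -> (k' <= b)%N ->
  bit (setbit u k c) k' = if k' == k then c else bit u k'.
Proof.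
move=> kb kb'; rewrite /bit /setbit.
have -> : (k' == k) = (inord k' == inord k :> 'I_b.+1).
  by rewrite -val_eqE /= !inordK.
by case: c; rewrite !inE; case: (_ == _).
Qed.

Lemma agree_setbit u k c : (k <= b)%N -> agree k.+1 (setbit u k c) u.
Proof.
move=> kb; apply/agreeP => k' /andP[kk' kb']; rewrite bit_setbit//.
by rewrite gtn_eqF.
Qed.

Lemma agree_bit i p u : (i <= b)%N -> agree i.+1 p u -> agree i p (setbit u i (bit p i)).
Proof.
move=> ib /agreeP h; apply/agreeP => k /andP[ik kb]; rewrite bit_setbit//.
by case: eqVneq => [->//|ki]; apply: h; rewrite kb ltn_neqAle eq_sym ki ik.
Qed.

Lemma card_agree i u : (i <= b.+1)%N -> (#|[set p | agree i p u]| <= 2 ^ i)%N.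
Proof.
elim: i u => [|i IH] u ib.
  rewrite (_ : [set _ | _] = [set u]) ?cards1//; apply/setP => p; rewrite !inE.
  apply/idP/eqP => [/forallP h|->]; last exact: agree_refl.
  by apply/setP => k; have /eqP := h k.
rewrite expnS mul2n -addnn.
apply: leq_trans (leq_add (IH (setbit u i true) (ltnW ib)) (IH (setbit u i false) (ltnW ib))).
apply: leq_trans (leq_card_setU _ _); apply: subset_leq_card; apply/subsetP => p.
by rewrite !inE => /(agree_bit ib); case: bit => ->; rewrite ?orbT.
Qed.

Definition free_below (i : nat) (e : elt) := forall p u, agree i p u -> cov e p = cov e u.

Lemma free_leq i j e : (i <= j)%N -> free_below j e -> free_below i e.
Proof. by move=> ij h p u /(agree_leq ij)/h. Qed.

Lemma free_fixbit i e c : (i <= b)%N -> free_below i.+1 e -> free_below i (fixbit e i c).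
Proof.
move=> ib h p u pu; rewrite !cov_fixbit (h p u); last exact: agree_leq pu.
by move/agreeP: pu => -> //; rewrite leqnn.
Qed.

(** Overwriting the bits of [u] below [i] with the values fixed by the request gives such a
    point. *)
Lemma pend_cov i e t d u q : (i <= b.+1)%N -> free_below i e -> cov e u ->
  q \in pend i e t d -> exists2 p, agree i p u & cov (target q) p.
Proof.
elim: i e u => [|i IH] e u ib eF eu /=.
  by rewrite inE => /eqP ->; exists u => //; exact: agree_refl.
have step c : q \in pend i (fixbit e i c) t d ->
    exists2 p, agree i.+1 p u & cov (target q) p.
  have us := agree_setbit u c ib.
  case/(IH _ (setbit u i c) (ltnW ib) (free_fixbit _ ib eF)).
    by rewrite cov_fixbit (eF _ _ us) eu bit_setbit// !eqxx.
  by move=> p pu qp; exists p => //; apply: agree_trans us; apply: agree_leq pu.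
by rewrite mem_cat => /orP[] /step.
Qed.

Definition plan := seq (nat * {set pt}).

(** The extra unit per transmission pays for all items that carry no point, as in [points_buy]. *)
Definition plan_cost (o : plan) : nat := \sum_(x <- o) #|x.2|.+1.

Definition buys (o : plan) (p : pt) : bool := has (fun x : nat * {set pt} => p \in x.2) o.

Definition serves (o : plan) (q : req) : bool :=
  has (fun x : nat * {set pt} => (arrival q <= x.1 <= due q)%N && [exists p in x.2, cov (target q) p]) o.

Definition timely (s t : nat) (o : plan) : bool := all (fun x => s <= x.1 < t)%N o.

Lemma plan_cost_cat o o' : plan_cost (o ++ o') = (plan_cost o + plan_cost o')%N.
Proof. by rewrite /plan_cost big_cat. Qed.

Lemma serves_catl o o' q : serves o q -> serves (o ++ o') q.
Proof. by rewrite /serves has_cat => ->. Qed.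

Lemma serves_catr o o' q : serves o' q -> serves (o ++ o') q.
Proof. by rewrite /serves has_cat orbC => ->. Qed.

Lemma timely_sub s t s' t' o : (s' <= s)%N -> (t <= t')%N -> timely s t o -> timely s' t' o.
Proof. by move=> ss tt; apply: sub_all => x /andP[a c]; lia. Qed.

Lemma buys_serves o t d q p : timely t d.+1 o -> arrival q = t -> due q = d ->
  buys o p -> cov (target q) p -> serves o q.
Proof.
move=> /allP oT qa qd /hasP[x xo px] qp; apply/hasP; exists x => //.
by rewrite qa qd -ltnS oT//=; apply/existsP; exists p; rewrite px.
Qed.

(** Buying all points that agree with [u], needed or not, lets the plan also serve the initial
    requests of enclosing instances. These points cost at most [2 ^ i], which leaves [2 ^ i] for the
    extra units of the transmissions. *)
Definition inst_opt (i : nat) (e : elt) (t : nat) (x : seq req) := forall u : pt,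
  free_below i e -> cov e u -> (i <= b.+1)%N ->
  exists o : plan, [/\ timely t (t + 2 ^ i) o, (plan_cost o <= 2 ^ i.+1)%N, all (serves o) x &
    forall p, agree i p u -> buys o p].

(** The point [z] encodes the subcube finally drawn. Its points, with the budget [2 ^ (i - j).+1],
    are left to the first subinstance of [inst]. *)
Lemma tail_opt g j i e s y u :
  (forall i e t x, x \in g i e t -> inst_opt i e t x) ->
  (j <= i)%N -> y \in tail g j i e s -> free_below i e -> cov e u -> (i <= b.+1)%N ->
  exists z o, [/\ agree i z u, timely s (s + 2 ^ i - 2 ^ (i - j)) o,
    (plan_cost o + 2 ^ (i - j).+1 <= 2 ^ i.+1)%N, all (serves o) y &
    forall p, agree i p u -> agree (i - j) p z || buys o p].
Proof.
move=> gO; elim: j i e s y u => [|j IH] [|i] e s y u //=.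
- move=> _; rewrite inE => /eqP -> _ _ _; exists u, [::]; split => //.
  + exact: agree_refl.
  + by rewrite /plan_cost big_nil.
  + by move=> p ->.
- move=> _; rewrite inE => /eqP -> _ _ _; exists u, [::]; split => //.
  + exact: agree_refl.
  + by rewrite /plan_cost big_nil.
  + by move=> p ->.
rewrite ltnS subSS => ji yt eF eu ib.
have [c /allpairsP[[y1 y2] /= [y1g y2t ->]]] : exists c, y \in [seq x ++ y |
    x <- g i (fixbit e i (~~ c)) s, y <- tail g j i (fixbit e i c) (s + 2 ^ i)].
  by move: yt; rewrite mem_cat => /orP[]; [exists false | exists true].
have us c' : cov (fixbit e i c') (setbit u i c').
  by rewrite cov_fixbit (eF _ _ (agree_setbit u c' ib)) eu bit_setbit// !eqxx.
have [w1 [w1T w1C w1S w1B]] := gO _ _ _ _ y1g _ (free_fixbit _ ib eF) (us _) (ltnW ib).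
have [z [w2 [zu w2T w2C w2S w2B]]] :=
  IH _ _ _ _ _ ji y2t (free_fixbit _ ib eF) (us _) (ltnW ib).
have E : (2 ^ (i - j) <= 2 ^ i)%N by rewrite leq_exp2l ?leq_subr.
exists z, (w1 ++ w2); split.
- exact: agree_trans (agree_leq (leqnSn i) zu) (agree_setbit u c ib).
- rewrite /timely all_cat; apply/andP; split.
    by apply: timely_sub w1T; rewrite ?expnS; lia.
  by apply: timely_sub w2T; rewrite ?expnS; lia.
- by rewrite plan_cost_cat; move: w1C w2C; rewrite !expnS; lia.
- rewrite all_cat; apply/andP; split.
    by apply: sub_all w1S => q; exact: serves_catl.
  by apply: sub_all w2S => q; exact: serves_catr.
- move=> p /(agree_bit ib) pu; rewrite /buys has_cat.
  (* Points with the drawn bit are left to the rest of the tail, the others are bought during the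
     subinstance on their half. *)
  have [pc|pc] := eqVneq (bit p i) c.
    by move: pu; rewrite pc => /w2B/orP[->//|]; rewrite /buys => ->; rewrite !orbT.
  have pc' : bit p i = ~~ c by move: pc; case: bit; case: (c).
  by move: pu; rewrite pc' => /w1B; rewrite /buys => ->; rewrite orbT.
Qed.

Lemma inst_optP f i e t x : x \in inst f i e t -> inst_opt i e t x.
Proof.
(* An empty instance still buys all its points, in one transmission. *)
have leaf i' e' t' : inst_opt i' e' t' [::].
  move=> u _ _ ib; exists [:: (t', [set p | agree i' p u])]; split => //=.
  - by rewrite /timely /= leqnn andbT -addn1 leq_add2l expn_gt0.
  - by rewrite /plan_cost big_seq1 /= expnS mul2n -addnn -addn1 leq_add ?card_agree ?expn_gt0.
  - by move=> p pu; rewrite /buys /= inE pu.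
elim: f i e t x => [|f IH] i e t x /=; first by rewrite inE => /eqP ->.
case: ltnP => [_|li]; first by rewrite inE => /eqP ->.
case/allpairsP => -[x1 y] /= [x1i yt ->] u eF eu ib.
have [z [w2 [zu w2T w2C w2S w2B]]] := tail_opt IH li yt eF eu ib.
have ez : cov e z by rewrite (eF _ _ zu).
(* Offline, the draws are known: the first subinstance is solved inside the subcube of [z]. *)
have [w1 [w1T w1C w1S w1B]] := IH _ _ _ _ x1i z (free_leq (leq_subr _ _) eF) ez
  (leq_trans (leq_subr _ _) ib).
have E : (2 ^ (i - l) <= 2 ^ i)%N by rewrite leq_exp2l ?leq_subr.
have E' : (0 < 2 ^ i)%N by rewrite expn_gt0.
have oT : timely t (t + 2 ^ i) (w1 ++ w2).
  rewrite /timely all_cat; apply/andP; split.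
    by apply: timely_sub w1T; lia.
  by apply: timely_sub w2T; lia.
have oB p : agree i p u -> buys (w1 ++ w2) p.
  rewrite /buys has_cat => /w2B/orP[/w1B|]; rewrite /buys => -> //.
  by rewrite orbT.
exists (w1 ++ w2); split => //.
- by rewrite plan_cost_cat; move: w1C w2C; lia.
- rewrite !all_cat; apply/and3P; split.
  + apply/allP => q qp; have [p pu qp'] := pend_cov ib eF eu qp.
    have [qa qd] := pendP qp.
    apply: buys_serves qa qd (oB _ pu) qp'.
    by rewrite prednK// addn_gt0 E' orbT.
  + by apply: sub_all w1S => q; exact: serves_catl.
  + by apply: sub_all w2S => q; exact: serves_catr.
Qed.

End Offline.
End Instances.
End Game.

(** * From the game to networks *)

Record covering (R : realType) (n : nat) (N : network R n) (b : nat) := Covering {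
  site : elt b -> 'I_n;
  points : {set item N} -> {set pt b};
  price_ge0 : forall i : item N, 0 <= price i;
  points_price : forall T, #|points T|%:R <= \sum_(i in T) price i;
  points_cov : forall T e, connects T (site e) -> exists2 p, p \in points T & cov e p;
  points_buy : forall Q : {set pt b}, exists T : {set item N},
    \sum_(i in T) price i <= #|Q|.+1%:R /\
    forall e p, p \in Q -> cov e p -> connects T (site e) }.

Section Reduction.
Context (R : realType) (n : nat) (N : network R n) (M : request_model R n) (b : nat).
Context (C : covering N b) (mk : req b -> request M).

(** A transmission after time [due q] but still in that slot counts as service in the game, so a
    penalty of 1 is demanded only one slot later. *)
Context (mk_vertex : forall q, vertex (mk q) = site C (target q))
  (mk_release : forall q, release (mk q) = (arrival q)%:R)
  (mk_ge0 : forall q t, ((arrival q)%:R%:E <= t -> 0 <= penalty (mk q) t)%E)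
  (mk_early : forall q (t : R), (arrival q)%:R <= t -> t <= (due q)%:R ->
    penalty (mk q) t%:E = 0%E)
  (mk_late : forall q t, (arrival q <= due q)%N ->
    ((due q).+1%:R%:E <= t)%E -> (1%:E <= penalty (mk q) t)%E).

Lemma service_time_ge (s : schedule N) (q : req b) :
  ((arrival q)%:R%:E <= service_time s (mk q))%E.
Proof.
apply: le_bigmin => [|x]; first exact: leey.
by rewrite mk_release lee_fin => /andP[].
Qed.

Lemma cost_ge0 (x : seq (req b)) (s : schedule N) : (0 <= cost (map mk x) s)%E.
Proof.
apply: adde_ge0; first by rewrite lee_fin sumr_ge0// => y _; apply: sumr_ge0 => i _; exact: price_ge0 C i.
rewrite big_map; apply: sume_ge0 => q _; apply: mk_ge0; exact: service_time_ge.
Qed.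

Lemma cost_plan (x : seq (req b)) (o : plan b) : all (serves o) x ->
  exists s : schedule N, (cost (map mk x) s <= (plan_cost o)%:R%:E)%E.
Proof.
move=> /allP ox; have [T T_buy] := choice (points_buy C).
exists [seq (y.1%:R, T y.2) | y <- o]; rewrite /cost !big_map.
rewrite [X in (_ + X)%E]big1_seq ?adde0.
  rewrite lee_fin /plan_cost natr_sum; apply: ler_sum => y _; exact: (T_buy _).1.
move=> q /andP[_ qx]; set s := service_time _ _.
have sq : ((arrival q)%:R%:E <= s)%E by exact: service_time_ge.
have {}sd : (s <= (due q)%:R%:E)%E.
  have /hasP[y yo /andP[/andP[ya yd] /existsP[p /andP[py pq]]]] := ox _ qx.
  apply: (@bigmin_inf_seq _ _ _ _ _ (y.1%:R, T y.2)).
  - by apply/mapP; exists y.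
  - by rewrite mk_release ler_nat ya mk_vertex; apply: (T_buy _).2 pq.
  - by rewrite lee_fin ler_nat.
move: sq sd; case: s => [r| |]//; rewrite !lee_fin; exact: mk_early.
Qed.

(* Slot [u] collects the transmissions made at real times in [u, u + 1). *)
Definition mult (s : schedule N) (u : nat) (p : pt b) : nat :=
  count (fun y => (u%:R <= y.1 < u.+1%:R) && (p \in points C y.2)) s.

(** Slots are half-open while [online] uses closed bounds; the copies of a pair [y] are compared at
    the bound [y.1] itself. *)
Lemma perm_filter_lt (s s' : schedule N) (c : R) :
  (forall t, t < c -> perm_eq [seq y <- s | y.1 <= t] [seq y <- s' | y.1 <= t]) ->
  perm_eq [seq y <- s | y.1 < c] [seq y <- s' | y.1 < c].
Proof.
move=> h; apply/allP => y _ /=; rewrite !count_filter.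
case: (ltP y.1 c) => yc; last first.
  rewrite !(@eq_count _ (predI _ _) pred0) ?count_pred0// => z /=;
    by case: eqP => // ->; rewrite ltNge yc.
have /permP/(_ (pred1 y)) := h _ yc; rewrite !count_filter => E.
apply/eqP; rewrite !(@eq_count _ (predI (pred1 y) (fun z => z.1 < c))
  (predI (pred1 y) (fun z => z.1 <= y.1))) // => z /=;
by case: eqP => // ->; rewrite yc lexx.
Qed.

Lemma mult_online (A : input M -> schedule N) : online A ->
  forall u (I J : seq (req b)),
    [seq q <- I | (arrival q <= u)%N] = [seq q <- J | (arrival q <= u)%N] ->
    mult (A (map mk I)) u =1 mult (A (map mk J)) u.
Proof.
move=> Ao u I J IJ p.
have /permP E : perm_eq [seq y <- A (map mk I) | y.1 < u.+1%:R]
    [seq y <- A (map mk J) | y.1 < u.+1%:R].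
  apply: perm_filter_lt => t tu; apply: Ao; rewrite !filter_map; congr map.
  (* Arrivals are integers, so a request released by a time [t < u + 1] arrives in slot [u] or
     before. *)
  have F (K : seq (req b)) : [seq q <- K | preim mk (fun q => release q <= t) q] =
      [seq q <- [seq q <- K | (arrival q <= u)%N] | release (mk q) <= t].
    rewrite -filter_predI; apply: eq_filter => q /=; rewrite mk_release.
    case: leP => //= qt; apply/esym; rewrite -ltnS -(ltr_nat R).
    exact: le_lt_trans tu.
  by rewrite (F I) (F J) IJ.
pose P (y : R * {set item N}) := (u%:R <= y.1 < u.+1%:R) && (p \in points C y.2).
have P_lt s : count (predI P (fun y => y.1 < u.+1%:R)) s = count P s.
  by apply: eq_count => y /=; rewrite /P; case: (y.1 < _); rewrite ?andbT ?andbF.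
by have := E P; rewrite !count_filter !P_lt.
Qed.

Lemma slots_le1 (r : R) T : (\sum_(0 <= u < T) (u%:R <= r < u.+1%:R)%R <= (0 <= r < T%:R)%R)%N.
Proof.
elim: T => [|T IH]; first by rewrite big_geq.
rewrite big_nat_recr//= (leq_trans (leq_add IH (leqnn _)))//.
have := ler0n R T; have : T%:R < T.+1%:R :> R by rewrite ltr_nat.
move: (T%:R) (T.+1%:R) => x y xy x0.
case: (leP 0 r); case: (ltP r x); case: (leP x r); case: (ltP r y) => //=; lra.
Qed.

Lemma cnt_cost (s : schedule N) (a : seq (req b) -> nat -> pt b -> nat) I T B :
  a I =2 mult s -> (cnt a I 0 T B <= \sum_(y <- s) #|points C y.2|)%N.
Proof.
move=> aE; apply: (@leq_trans (\sum_(0 <= u < T) \sum_p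
    \sum_(y <- s) ((u%:R <= y.1 < u.+1%:R)%R && (p \in points C y.2)))%N).
  apply: leq_sum => u _; rewrite [leqRHS](bigID B)/=.
  apply: leq_trans (leq_addr _ _); apply: leq_sum => p _.
  by rewrite aE /mult -sum1_count big_mkcond.
under eq_bigr do rewrite exchange_big.
rewrite exchange_big; apply: leq_sum => y _ /=.
have E u : (\sum_p ((u%:R <= y.1 < u.+1%:R)%R && (p \in points C y.2)) =
    (u%:R <= y.1 < u.+1%:R)%R * #|points C y.2|)%N.
  case: (_ <= y.1 < _)%R => /=; last by rewrite big1.
  by rewrite mul1n -sum1_card [RHS]big_mkcond.
under eq_bigr do rewrite E.
rewrite -big_distrl/= -[leqRHS]mul1n leq_mul2r (leq_trans (slots_le1 _ _)) ?leq_b1//.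
by rewrite orbT.
Qed.

Lemma late_service (s : schedule N) (a : seq (req b) -> nat -> pt b -> nat) I q :
  a I =2 mult s -> unserved a I q -> ((due q).+1%:R%:E <= service_time s (mk q))%E.
Proof.
move=> aE; rewrite /unserved /cnt => /eqP q0.
rewrite /service_time big_seq_cond; apply: le_bigmin => [|y]; first exact: leey.
case/and3P => ys; rewrite mk_release mk_vertex => qy /points_cov[p py qp].
rewrite lee_fin leNgt; apply/negP => yd.
have y0 : 0 <= y.1 by rewrite (le_trans _ qy).
(* A transmission before time [due q + 1] lies in a slot where it would count as service. *)
have /andP[u1 u2] := truncn_itv y0; set u := Num.truncn y.1 in u1 u2.
have ua : (arrival q <= u < (due q).+1)%N.
  rewrite -(ltr_nat R) (le_lt_trans u1 yd) andbT -ltnS -(ltr_nat R).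
  exact: le_lt_trans u2.
move: q0; rewrite (big_rem u) ?mem_index_iota//= => /eqP.
rewrite addn_eq0 (bigD1 p)//= !addn_eq0 aE => /andP[/andP[/eqP m0 _] _].
suff : (0 < mult s u p)%N by rewrite m0.
by rewrite -has_count; apply/hasP; exists y => //; rewrite u1 u2.
Qed.

Lemma charge_cost l f i e x (A : input M -> schedule N) : x \in inst l f i e 0 ->
  (((toll (fun I => mult (A (map mk I))) R x 0 (2 ^ i) e x)%:E
    <= cost (map mk x) (A (map mk x))))%E.
Proof.
move=> /inst_within/allP xW; rewrite /toll natrD EFinD; apply: leeD.
  rewrite lee_fin (@le_trans _ _ (\sum_(y <- A (map mk x)) #|points C y.2|)%:R)//.
    by rewrite ler_nat cnt_cost.
  by rewrite natr_sum; apply: ler_sum => y _; exact: points_price.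
rewrite big_map /nuns -sum1_count natr_sum -sumEFin big_mkcond/=.
rewrite big_seq [leRHS]big_seq; apply: lee_sum => q qx.
case: ifPn => [qu|_]; last by apply: mk_ge0; exact: service_time_ge.
apply: mk_late; first by have /andP[/andP[]] := xW _ qx.
exact: late_service qu.
Qed.

(** Finiteness of the optimum turns [alpha * opt] into a product of reals. *)
Lemma opt_bound l f e x : free_below b e -> cov e set0 -> x \in inst l f b e 0 ->
  exists2 v : R, 0 <= v <= 2 ^+ b.+1 & opt N (map mk x) = v%:E.
Proof.
move=> eF e0 /inst_optP/(_ set0 eF e0 (leqnSn b)) [ o [_ oC oS _]].
have [s sC] := cost_plan oS.
have h0 : (0 <= opt N (map mk x))%E by apply: le_ereal_inf_tmp => _ [s' _ <-]; exact: cost_ge0.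
have h1 : (opt N (map mk x) <= (2 ^+ b.+1)%:E)%E.
  apply: (@le_trans _ _ (cost (map mk x) s)); first by apply: ereal_inf_lbound; exists s.
  by apply: le_trans sC _; rewrite lee_fin -natrX ler_nat.
case: (opt N (map mk x)) h0 h1 => [v| |]//; rewrite !lee_fin => v0 v1.
by exists v; rewrite ?v0 ?v1.
Qed.

(** Yao's principle: the lower bound holds for each seed on average over [L], hence for the expected
    costs, while competitiveness bounds each of these through [opt]. *)
Theorem competitive_ratio_bound l (A : randomized_algorithm N M) (alpha : R) :
  (0 < l)%N -> (l < b)%N -> (b <= 2 * 4 ^ l + l)%N ->
  (forall I, (expected_cost A I <= alpha%:E * opt N I)%E) ->
  (b - l)%:R / (8 * 2 ^+ l) <= alpha.
Proof.
move=> l0 lb bB Aalpha.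
pose e : elt b := (set0, set0).
have covE p : cov e p by rewrite /cov sub0set disjoints_subset sub0set.
have eF : free_below b e by move=> p u _; rewrite !covE.
pose L := inst l b.+1 b e 0.
have L0 : (0 < size L)%N by exact: size_inst_gt0.
pose r : R := alg_lb l R b.
have lower (w : seed A) : ((((size L)%:R * r)%:E <= \sum_(x <- L) cost (map mk x) (run w (map mk x))))%E.
  have := @inst_bound b l _ (mult_online (@run_online _ _ _ _ A w)) R b.+1 b e 0 [::]
    l0 (ltnSn b) bB.
  rewrite /avg ler_pdivlMr ?ltr0n// mulrC -lee_fin => /le_trans; apply.
  rewrite -sumEFin big_seq [leRHS]big_seq; apply: lee_sum => x xL.
  exact: charge_cost xL.
have : (((size L)%:R * r)%:E <= \sum_(x <- L) expected_cost A (map mk x))%E.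
  rewrite /expected_cost -ge0_integral_sum//.
  - rewrite -[leLHS]mule1 -(probability_setT (seed_law A)) -integral_cst//.
    apply: ge0_le_integral => //.
    + by move=> w _ /=; rewrite lee_fin mulr_ge0// /r /alg_lb divr_ge0 ?mulr_ge0.
    + by apply: emeasurable_sum => x; exact: run_measurable.
  - by move=> x; exact: run_measurable.
  - by move=> x w _; exact: cost_ge0.
(* [Num.max alpha 0] accommodates a negative [alpha], excluded at the end because the lower bound is
   positive. *)
have upper : (\sum_(x <- L) expected_cost A (map mk x) <=
    ((size L)%:R * (Num.max alpha 0 * 2 ^+ b.+1))%:E)%E.
  rewrite (_ : (_ * _)%:E = \sum_(x <- L) (Num.max alpha 0 * 2 ^+ b.+1)%:E)%E; last first.
    by rewrite mulr_natl sumEFin big_const_seq count_predT iter_addr addr0.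
  rewrite big_seq [leRHS]big_seq; apply: lee_sum => x xL; apply: le_trans (Aalpha _) _.
  have [v /andP[v0 v1] ->] := opt_bound eF (covE _) xL.
  rewrite lee_fin; apply: (@le_trans _ _ (Num.max alpha 0 * v)).
    by rewrite ler_wpM2r// le_max lexx.
  by rewrite ler_wpM2l// le_max lexx orbT.
move=> /le_trans/(_ upper); rewrite lee_fin ler_pM2l ?ltr0n//.
have bl : 0 < (b - l)%:R / (8 * 2 ^+ l) :> R.
  by rewrite divr_gt0 ?mulr_gt0 ?exprn_gt0 ?ltr0n ?subn_gt0.
have -> : r = (b - l)%:R / (8 * 2 ^+ l) * 2 ^+ b.+1.
  rewrite /r /alg_lb exprS; have : (2 ^+ l : R) != 0 by rewrite expf_neq0.
  by move=> l2; field.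
rewrite ler_pM2r ?exprn_gt0// le_max => /orP[//|].
by move: bl => /lt_le_trans/[apply]; rewrite ltxx.
Qed.
End Reduction.

Lemma connect_last (T : finType) (e : rel T) (x y : T) :
  connect e x y -> x != y -> exists2 z, connect e x z & e z y.
Proof.
move=> /connectP[p]; case/lastP: p => [_ ->|p z]; first by rewrite eqxx.
rewrite rcons_path last_rcons => /andP[ep ez] -> _.
by exists (last x p) => //; apply/connectP; exists p.
Qed.

(** * Deadlines and delays *)

Section Models.
Context (R : realType) (n b : nat) (N : network R n) (C : covering N b).

(* The [maxn] only makes the deadline legal in the irrelevant case [due q < arrival q]. *)
Lemma mk_deadline_le (q : req b) :
  (arrival q)%:R <= (maxn (arrival q) (due q))%:R :> R.
Proof. by rewrite ler_nat leq_maxl. Qed.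

Definition mk_deadline (q : req b) : request (deadlines R n) :=
  DeadlineRequest (site C (target q)) (mk_deadline_le q).

Lemma deadline_bound l (A : randomized_algorithm N (deadlines R n)) (alpha : R) :
  (0 < l)%N -> (l < b)%N -> (b <= 2 * 4 ^ l + l)%N ->
  (forall I, (expected_cost A I <= alpha%:E * opt N I)%E) ->
  (b - l)%:R / (8 * 2 ^+ l) <= alpha.
Proof.
apply: (@competitive_ratio_bound R n N (deadlines R n) b C mk_deadline) => //.
- by move=> q t _ /=; case: ifP; rewrite ?leey.
- move=> q t _ td /=; rewrite lee_fin (le_trans td)// ler_nat; exact: leq_maxr.
- move=> q t qd td /=; rewrite ifF ?leey//; apply/negbTE; rewrite -ltNge.
  by apply: lt_le_trans td; rewrite lte_fin ltr_nat ltnS geq_max qd leqnn.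
Qed.

(** The slope 1 makes the delay reach the price of a point one slot after the due time. *)
Definition ramp (d t : R) : R := Num.max 0 (t - d).

Lemma ramp_continuous d : continuous (ramp d).
Proof.
move=> t; apply: (@continuous_max R R^o (cst 0) (fun t => t - d)); first exact: cst_continuous.
by apply: cvgB; [exact: cvg_id | exact: cvg_cst].
Qed.

Lemma ramp_infty d : (ramp d t @[t --> +oo] --> +oo)%classic.
Proof.
apply/cvgryPge => c; near=> t; rewrite /ramp le_max; apply/orP; right.
by rewrite lerBrDr; near: t; apply: nbhs_pinfty_ge; exact: num_real.
Unshelve. all: by end_near. Qed.

Definition mk_delay (q : req b) : request (delays R n).
Proof.
apply: (@DelayRequest R n (site C (target q)) (arrival q)%:R (ramp (due q)%:R)).
- by move=> t _; rewrite /ramp le_max lexx.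
- by apply: continuous_subspaceT; exact: ramp_continuous.
- by move=> s t _ st; rewrite /ramp ge_max !le_max lexx lerD2r st orbT.
- exact: ramp_infty.
Defined.

Lemma delay_bound l (A : randomized_algorithm N (delays R n)) (alpha : R) :
  (0 < l)%N -> (l < b)%N -> (b <= 2 * 4 ^ l + l)%N ->
  (forall I, (expected_cost A I <= alpha%:E * opt N I)%E) ->
  (b - l)%:R / (8 * 2 ^+ l) <= alpha.
Proof.
apply: (@competitive_ratio_bound R n N (delays R n) b C mk_delay) => //.
- by move=> q [t| |]//= _; rewrite lee_fin /ramp le_max lexx.
- by move=> q t _ td /=; rewrite /ramp max_l ?subr_le0.
- move=> q [t| |] _ /=; rewrite ?leey//.
  rewrite !lee_fin /ramp le_max => td; apply/orP; right.
  by rewrite lerBrDr addrC natr1.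
Qed.

End Models.

(** * Graphs with three layers: root, points, elements *)

Section Graphs.
Context (R : realType) (n b : nat).

Definition vert := option (pt b + elt b).

Context (vert_le : (#|{: vert}| <= n)%N).

Definition enc (x : vert) : 'I_n := widen_ord vert_le (enum_rank x).

(** [None] marks the isolated vertices that pad the graph to exactly [n] vertices. *)
Definition dec (v : 'I_n) : option vert := [pick x | enc x == v].

Lemma enc_inj : injective enc.
Proof.
move=> x y /(congr1 val) /= xy; apply: enum_rank_inj; exact: val_inj.
Qed.

Lemma encK : pcancel enc dec.
Proof.
move=> x; rewrite /dec; case: pickP => [y /eqP/enc_inj ->//|/(_ x)].
by rewrite eqxx.
Qed.

Lemma decP v x : dec v = Some x -> v = enc x.
Proof. by rewrite /dec; case: pickP => // y /eqP <- [->]. Qed.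

Definition root : vert := None.
Definition vpt (p : pt b) : vert := Some (inl p).
Definition velt (e : elt b) : vert := Some (inr e).

Definition darc (x y : option vert) : bool :=
  match x, y with
  | Some None, Some (Some (inl _)) => true
  | Some (Some (inl p)), Some (Some (inr e)) => cov e p
  | _, _ => false
  end.

Lemma darc_elt v e : darc (dec v) (Some (velt e)) -> exists2 p, v = enc (vpt p) & cov e p.
Proof.
by case E: (dec v) => [[[p|]|]|]//= ep; exists p => //; apply: decP.
Qed.

Lemma darc_pt v p : darc (dec v) (Some (vpt p)) -> v = enc root.
Proof. by case E: (dec v) => [[[]|]|]//= _; apply: decP. Qed.

Lemma n_gt0 : (0 < n)%N.
Proof. exact: leq_ltn_trans (ltn_ord (enc root)). Qed.

Definition nw_adj : rel 'I_n :=
  [rel u v | darc (dec u) (dec v) || darc (dec v) (dec u)].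

Lemma nw_adj_sym : symmetric nw_adj.
Proof. by move=> u v; rewrite /nw_adj /= orbC. Qed.

Lemma nw_adj_irr : irreflexive nw_adj.
Proof. by move=> u; rewrite /nw_adj /= orbb; case: (dec u) => [[[]|]|]. Qed.

(** Costs must be positive; at [1 / n] each, all vertices other than points cost at most 1
    together. *)
Definition nw_cost (v : 'I_n) : R :=
  if dec v is Some (Some (inl _)) then 1 else n%:R^-1.

Lemma nw_cost_gt0 v : 0 < nw_cost v.
Proof.
by rewrite /nw_cost; case: (dec v) => [[[]|]|]; rewrite ?invr_gt0 ?ltr0n ?n_gt0.
Qed.

Definition nw_graph : node_weighted_graph R n :=
  NodeWeightedGraph nw_adj_sym nw_adj_irr nw_cost_gt0 (enc root).

Definition nw_pts (T : {set 'I_n}) : {set pt b} := [set p | enc (vpt p) \in T].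

Lemma enc_vpt_inj : injective (enc \o vpt).
Proof. by apply: inj_comp enc_inj _ => p q []. Qed.

Lemma nw_pts_price (T : {set 'I_n}) : #|nw_pts T|%:R <= \sum_(v in T) nw_cost v.
Proof.
rewrite -sum1_card natr_sum.
apply: (@le_trans _ _ (\sum_(v in [set enc (vpt p) | p in nw_pts T]) nw_cost v)).
  rewrite big_imset/=; last by move=> p q _ _; exact: enc_vpt_inj.
  by apply: ler_sum => p _; rewrite /nw_cost encK.
rewrite [leLHS]big_mkcond [leRHS]big_mkcond; apply: ler_sum => v _.
case: ifPn => [/imsetP[p]|_]; first by rewrite inE => pT ->; rewrite pT.
by case: ifP => // _; exact/ltW/nw_cost_gt0.
Qed.

(** The only neighbours of an element are the points in it. *)
Lemma nw_pts_cov (T : {set 'I_n}) e : induced_connects nw_graph T (enc (velt e)) ->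
  exists2 p, p \in nw_pts T & cov e p.
Proof.
case/and3P => _ _ /connect_last[|v _ /and3P[vT _]]; first by apply/eqP => /enc_inj.
rewrite /= /nw_adj /= encK => /orP[/darc_elt[p vp ep]|//].
by exists p; rewrite // inE -vp.
Qed.

Lemma nw_pts_buy (Q : {set pt b}) : exists T : {set 'I_n},
  \sum_(v in T) nw_cost v <= #|Q|.+1%:R /\
  forall e p, p \in Q -> cov e p -> induced_connects nw_graph T (enc (velt e)).
Proof.
(* Everything is bought except the points outside [Q]. *)
exists [set v | if dec v is Some (Some (inl p)) then p \in Q else true]; split.
  apply: (@le_trans _ _ (\sum_(v : 'I_n) (n%:R^-1 + (v \in [set enc (vpt p) | p in Q])%:R))).
    rewrite [leLHS]big_mkcond; apply: ler_sum => v _; rewrite inE /nw_cost.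
    have n0 : 0 <= n%:R^-1 :> R by [].
    case E: (dec v) => [[[p|e]|]|]; rewrite ?lerDl//.
    case: ifP => pQ; last by rewrite addr_ge0.
    have -> : v \in [set enc (vpt p) | p in Q] by apply/imsetP; exists p => //; exact: decP.
    by rewrite lerDr.
  rewrite big_split/= sumr_const card_ord -[_ *+ n]mulr_natl mulfV; last first.
    by rewrite pnatr_eq0 -lt0n n_gt0.
  rewrite -natr_sum -big_mkcond/= sum1_card -natr1 addrC lerD2r ler_nat.
  exact: leq_imset_card.
move=> e p pQ ep; rewrite /induced_connects !inE !encK /=.
apply: (@connect_trans _ _ (enc (vpt p))); apply: connect1; rewrite /= !inE !encK /= pQ;
by rewrite /nw_adj /= !encK //= ep.
Qed.

Definition nw_covering : covering (node_weighted_network nw_graph) b :=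
  @Covering R n (node_weighted_network nw_graph) b (enc \o velt) nw_pts
    (fun v => ltW (nw_cost_gt0 v)) nw_pts_price nw_pts_cov nw_pts_buy.

Definition dr_arcs : {set 'I_n * 'I_n} := [set a | darc (dec a.1) (dec a.2)].

(** The arc from the root to a point stands for that point; the others, at most [n * n], cost at
    most 1 together. *)
Definition dr_cost (a : {a : 'I_n * 'I_n | a \in dr_arcs}) : R :=
  if dec (val a).1 == Some root then 1 else (n * n)%:R^-1.

Lemma dr_cost_gt0 a : 0 < dr_cost a.
Proof.
by rewrite /dr_cost; case: ifP; rewrite ?invr_gt0 ?ltr0n ?muln_gt0 ?n_gt0.
Qed.

Definition dr_graph : edge_weighted_digraph R n :=
  EdgeWeightedDigraph dr_cost_gt0 (enc root).

Notation arc := {a : 'I_n * 'I_n | a \in dr_arcs}.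

Definition dr_pts (T : {set arc}) : {set pt b} :=
  [set p | [exists a in T, val a == (enc root, enc (vpt p))]].

Lemma dr_pts_price (T : {set arc}) : #|dr_pts T|%:R <= \sum_(a in T) dr_cost a.
Proof.
pose T' := [set a in T | dec (val a).1 == Some root].
apply: (@le_trans _ _ (\sum_(a in T') dr_cost a)).
  apply: (@le_trans _ _ #|T'|%:R).
    rewrite ler_nat -(card_imset _ enc_vpt_inj).
    apply: leq_trans (leq_imset_card (fun a : arc => (val a).2) T').
    apply: subset_leq_card; apply/subsetP => v /imsetP[p].
    rewrite inE => /existsP[a /andP[aT /eqP ap]] ->; apply/imsetP; exists a; last by rewrite ap.
    by rewrite inE aT ap encK eqxx.
  rewrite -sum1_card natr_sum; apply: ler_sum => a.
  by rewrite inE /dr_cost => /andP[_ ->].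
rewrite [leLHS]big_mkcond [leRHS]big_mkcond; apply: ler_sum => a _.
rewrite inE; case: (a \in T) => //=; case: ifP => // _; exact/ltW/dr_cost_gt0.
Qed.

(** Arcs into an element come from points in it, and arcs into a point come from the root. *)
Lemma dr_pts_cov (T : {set arc}) e : directed_connects (G := dr_graph) T (enc (velt e)) ->
  exists2 p, p \in dr_pts T & cov e p.
Proof.
case/connect_last => [|v rv /existsP[a /andP[aT /eqP av]]]; first by apply/eqP => /enc_inj.
have : val a \in dr_arcs := valP a.
rewrite av inE /= encK => /darc_elt[p vp ep]; exists p => //.
move: rv; rewrite vp => /connect_last[|w _ /existsP[a' /andP[aT' /eqP av']]].
  by apply/eqP => /enc_inj.
have : val a' \in dr_arcs := valP a'.
rewrite av' inE /= encK => /darc_pt wr; rewrite inE.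
by apply/existsP; exists a'; rewrite aT' av' wr /=.
Qed.

Lemma dr_pts_buy (Q : {set pt b}) : exists T : {set arc},
  \sum_(a in T) dr_cost a <= #|Q|.+1%:R /\
  forall e p, p \in Q -> cov e p -> directed_connects (G := dr_graph) T (enc (velt e)).
Proof.
pose S := [set (enc root, enc (vpt p)) | p in Q].
exists [set a : arc | (dec (val a).1 == Some root) ==> (val a \in S)]; split.
  apply: (@le_trans _ _ (\sum_(a : arc) ((n * n)%:R^-1 + (val a \in S)%:R))).
    rewrite [leLHS]big_mkcond; apply: ler_sum => a _; rewrite inE /dr_cost.
    have n0 : 0 <= (n * n)%:R^-1 :> R by [].
    case: eqP => _ /=; last by rewrite lerDl.
    by case: (val a \in S); rewrite ?lerDr ?addr_ge0.
  rewrite big_split/= sumr_const -[_ *+ _]mulr_natl -natr1 addrC lerD//.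
    rewrite -natr_sum -big_mkcond/= sum1_card ler_nat -(card_imset _ val_inj).
    apply: leq_trans (leq_imset_card (fun p => (enc root, enc (vpt p))) Q).
    by apply: subset_leq_card; apply/subsetP => _ /imsetP[a aS ->].
  rewrite ler_pdivrMr ?mul1r ?ltr0n ?muln_gt0 ?n_gt0// ler_nat card_sig.
  by rewrite (leq_trans (max_card _))// card_prod !card_ord.
move=> e p pQ ep; rewrite /directed_connects.
have h1 : (enc root, enc (vpt p)) \in dr_arcs by rewrite inE /= !encK.
have h2 : (enc (vpt p), enc (velt e)) \in dr_arcs by rewrite inE /= !encK /=.
apply: (@connect_trans _ _ (enc (vpt p))); apply: connect1; apply/existsP.
  exists (exist (fun a => a \in dr_arcs) _ h1); rewrite inE /= eqxx andbT; apply/implyP => _.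
  by apply/imsetP; exists p.
by exists (exist (fun a => a \in dr_arcs) _ h2); rewrite inE /= eqxx andbT encK.
Qed.

Definition dr_covering : covering (directed_network dr_graph) b :=
  @Covering R n (directed_network dr_graph) b (enc \o velt) dr_pts
    (fun a => ltW (dr_cost_gt0 a)) dr_pts_price dr_pts_cov dr_pts_buy.

End Graphs.

(** * Choice of the parameters *)

Theorem theoremA1 (R : realType) :
  exists2 c : R, 0 < c & exists n0 : nat, forall n : nat, (n0 <= n)%N ->
    [/\ forall (A : forall G : node_weighted_graph R n,
                  randomized_algorithm (node_weighted_network G) (deadlines R n))
               (alpha : R),
          competitive A alpha -> c * Num.sqrt (ln n%:R) <= alpha,
        forall (A : forall G : node_weighted_graph R n,
                  randomized_algorithm (node_weighted_network G) (delays R n))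
               (alpha : R),
          competitive A alpha -> c * Num.sqrt (ln n%:R) <= alpha,
        forall (A : forall G : edge_weighted_digraph R n,
                  randomized_algorithm (directed_network G) (deadlines R n))
               (alpha : R),
          competitive A alpha -> c * Num.sqrt (ln n%:R) <= alpha &
        forall (A : forall G : edge_weighted_digraph R n,
                  randomized_algorithm (directed_network G) (delays R n))
               (alpha : R),
          competitive A alpha -> c * Num.sqrt (ln n%:R) <= alpha].
Proof.
(* As [b = 4 ^ l] and [2 * l <= b], the ratio is at least [2 ^ l / 16 = (8 * 2 ^ l) / 128], and
   [8 * 2 ^ l] dominates the square root of [ln n]. *)
exists (128^-1); first by rewrite invr_gt0.
(* This threshold gives [4 <= k], hence [0 < l]. *)
exists (16 ^ 4)%N => n n_large.
have n0 : (0 < n)%N by apply: leq_trans n_large; rewrite expn_gt0.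
pose k := trunc_log 16 n; pose l := trunc_log 4 k; pose b := (4 ^ l)%N.
have /andP[nk nk'] : (16 ^ k <= n < 16 ^ k.+1)%N by exact: trunc_log_bounds.
have k4 : (4 <= k)%N by apply: trunc_log_max.
have /andP[kb kb'] : (4 ^ l <= k < 4 ^ l.+1)%N.
  by apply: trunc_log_bounds; rewrite ?(leq_trans _ k4).
have l0 : (0 < l)%N by apply: trunc_log_max.
have lb : (2 * l <= b)%N.
  rewrite /b; clear -l0; elim: l l0 => // -[|l] IH _ //.
  by rewrite expnS; have := IH isT; lia.
have b4 : (4 <= b)%N by rewrite /b -[leqLHS]expn1 leq_exp2l.
have lb' : (l < b)%N by lia.
have bB : (b <= 2 * 4 ^ l + l)%N by rewrite -/b; lia.
(* The [1 + 2 ^ b.+1 + 4 ^ b.+1] vertices number at most [4 ^ (b + 2)], hence at most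
   [16 ^ b <= n]. *)
have vn : (#|{: vert b}| <= n)%N.
  apply: leq_trans nk; apply: (@leq_trans (16 ^ b)); last by rewrite leq_exp2l.
  have cpt : #|{: pt b}| = (2 ^ b.+1)%N.
    by rewrite -cardsT -powersetT card_powerset cardsT card_ord.
  rewrite card_option card_sum card_prod !cpt -expnD.
  rewrite (_ : 16 = 2 ^ 4)%N// -expnM.
  have h1 : (2 ^ b.+1 <= 2 ^ (b.+1 + b.+1))%N by rewrite leq_exp2l// leq_addr.
  have h2 : (0 < 2 ^ (b.+1 + b.+1))%N by rewrite expn_gt0.
  apply: (@leq_trans (2 ^ (b.+1 + b.+1).+2)); last by rewrite leq_exp2l//; lia.
  have -> : (2 ^ (b.+1 + b.+1).+2 = 4 * 2 ^ (b.+1 + b.+1))%N by rewrite -[4%N]/(2 ^ 2)%N -expnD.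
  by move: h1 h2; move: (2 ^ (b.+1 + b.+1))%N (2 ^ b.+1)%N => x y; clear; lia.
have sqrt_le : 128^-1 * Num.sqrt (ln n%:R) <= (b - l)%:R / (8 * 2 ^+ l) :> R.
  have h1 : ln n%:R <= (8 * 2 ^+ l) ^+ 2 :> R.
    (* Since [k < 4 ^ l.+1], bounding [ln 16] by 16 yields [ln n <= 64 * 4 ^ l]. *)
    have : ln n%:R <= ln (16 ^+ (4 ^ l.+1)) :> R.
      rewrite ler_ln ?posrE ?exprn_gt0 ?ltr0n// -natrX ler_nat.
      by apply: leq_trans (ltnW nk') _; rewrite leq_exp2l.
    move=> /le_trans; apply; rewrite lnXn// -[leLHS]mulr_natr.
    apply: (@le_trans _ _ (16 * (4 ^ l.+1)%:R)).
      by rewrite ler_wpM2r// ltW// ln_sublinear.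
    rewrite -natrX -!natrM -natrX ler_nat expnS (_ : 4 = 2 ^ 2)%N// -expnM.
    by rewrite expnMn -expnM mulnC [(l * 2)%N]mulnC; lia.
  have h2 : Num.sqrt (ln n%:R) <= 8 * 2 ^+ l :> R.
    by rewrite -[leRHS]ger0_norm ?mulr_ge0 ?exprn_ge0// -sqrtr_sqr ler_wsqrtr.
  apply: (@le_trans _ _ (128^-1 * (8 * 2 ^+ l))); first by rewrite ler_wpM2l.
  rewrite ler_pdivlMr ?mulr_gt0 ?exprn_gt0//.
  have h3 : (b%:R : R) = 2 ^+ l * 2 ^+ l.
    by rewrite /b -exprMn natrX -natrM.
  have h4 : b%:R <= 2 * (b - l)%:R :> R by rewrite -natrM ler_nat; lia.
  by move: h4; rewrite h3; move: (2 ^+ l) => x; lra.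
split=> A alpha Aalpha; apply: le_trans sqrt_le _.
- exact: deadline_bound (nw_covering R vn) _ _ _ l0 lb' bB (Aalpha _).
- exact: delay_bound (nw_covering R vn) _ _ _ l0 lb' bB (Aalpha _).
- exact: deadline_bound (dr_covering R vn) _ _ _ l0 lb' bB (Aalpha _).
- exact: delay_bound (dr_covering R vn) _ _ _ l0 lb' bB (Aalpha _).
Qed.
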